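(* For $1\le i\le k$, let $P_i$ be a lower-L-bounded poset with $\hat 0$ and with a large interval $I_i$. Then $$P_1\oplus_I\cdots\oplus_I P_k$$ is lower-L-bounded.
   Context: All posets are finite and nonempty. Let $[n]=\{1,\dots,n\}$; families of subsets of $[n]$ are ordered by inclusion. A poset $(P,\le)$ contains a poset $(P',\le')$ as a (weak) subposet if there is an injection $f:P'\to P$ such that $u\le' v$ implies $f(u)\le f(v)$. A family $\mathcal F\subseteq 2^{[n]}$ is $P$-free if it does not contain $P$ in this sense. $e(P)$ is the maximum integer $k\ge 0$ such that for all integers $n$ and $s$ the family $\binom{[n]}{s}\cup\binom{[n]}{s+1}\cup\cdots\cup\binom{[n]}{s+k-1}$ is $P$-free, where $\binom{[n]}{j}$ is the collection of $j$-element subsets of $[n]$ (empty if $j<0$ or $j>n$). The Lubell function of $\mathcal F\subseteq 2^{[n]}$ is the average over all $n!$ full (maximal) chains $\mathcal C$ of $2^{[n]}$ of $|\mathcal F\cap\mathcal C|$; equivalently $\bar h_n(\mathcal F)=\sum_{F\in\mathcal F}1/\binom{n}{|F|}$. $P$ is lower-L-bounded if for any $\beta\in(\frac12,1)$ and $\varepsilon>0$ there exists $N=N(\beta,\varepsilon)$ such that for all $n\ge N$, $\bar h_n(\mathcal F)\le e(P)+\varepsilon$ for all $P$-free families $\mathcal F$ of subsets of $[n]$ of sizes less than $\beta n$. An element $x$ of a poset $P$ is $\hat 0$ if $x\le p$ for all $p\in P$. For $a\le b$ in $P$, the interval $[a,b]$ is the subposet $\{c\in P: a\le c\le b\}$.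 A large interval of $P$ is a maximal (under inclusion) interval $I$ of $P$ with $e(I)=e(P)$ (it need not be unique). Given posets $P_1,\dots,P_k$ with chosen large intervals $I_1,\dots,I_k$, $P_1\oplus_I\cdots\oplus_I P_k$ denotes the poset obtained from the disjoint union of the $P_i$ by identifying, for $1\le i\le k-1$, the maximal element of $I_i$ with the minimal element of $I_{i+1}$, the order being the transitive closure of the union of the orders of the $P_i$. The operation depends on the choice of the large intervals. *)

(* Defs.v *)
From HB Require Import structures.
From mathcomp Require Import boolp classical_sets reals.
From mathcomp Require Import all_boot all_order all_algebra perm.
From mathcomp Require Import zify.

Set Implicit Arguments.
Unset Strict Implicit.
Unset Printing Implicit Defensive.

Import Order.TTheory GRing.Theory Num.Theory.

Local Open Scope ring_scope.

(* The ground set [n] is ['I_n]; a family of subsets is a [{set {set 'I_n}}]. *)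

Definition subposet_of d (P : finPOrderType d) n (F : {set {set 'I_n}}) : Prop :=
  exists f : P -> {set 'I_n},
    [/\ injective f, forall u, f u \in F & forall u v, (u <= v)%O -> f u \subset f v].

Definition poset_free d (P : finPOrderType d) n (F : {set {set 'I_n}}) : Prop :=
  ~ subposet_of P F.

(* Integer-valued [j], so that levels below 0 are empty. *)
Definition level n (j : int) : {set {set 'I_n}} := [set A : {set 'I_n} | #|A|%:Z == j].

Definition levels n (s : int) (k : nat) : {set {set 'I_n}} :=
  \bigcup_(j < k) level n (s + j%:Z).

Definition levels_free d (P : finPOrderType d) (k : nat) : Prop :=
  forall (n : nat) (s : int), poset_free P (levels n s k).

Definition is_e d (P : finPOrderType d) (m : nat) : Prop :=
  levels_free P m /\ forall k, levels_free P k -> (k <= m)%N.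

(* For nonempty [P] the maximum exists, see [e_ofP] below; the default value
   0 is only used for the empty poset. *)
Definition e_of d (P : finPOrderType d) : nat := xget 0%N [set m | is_e P m]%classic.

Definition chain n (C : {set {set 'I_n}}) : bool :=
  [forall A in C, forall B in C, (A \subset B) || (B \subset A)].

Definition full_chains n : {set {set {set 'I_n}}} :=
  [set C | maxset (@chain n) C].

(* Average over the full chains; see [lubellE] below for the formula as a sum of
   inverse binomial coefficients. *)
Definition lubell (R : realType) n (F : {set {set 'I_n}}) : R :=
  (\sum_(C in full_chains n) #|F :&: C|%:R) / #|full_chains n|%:R.

Definition lower_L_bounded (R : realType) d (P : finPOrderType d) : Prop :=
  forall beta eps : R, 2^-1 < beta < 1 -> 0 < eps ->
  exists N : nat, forall n : nat, (N <= n)%N ->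
  forall F : {set {set 'I_n}}, poset_free P F ->
  (forall A, A \in F -> #|A|%:R < beta * n%:R) ->
  lubell R F <= (e_of P)%:R + eps.

Definition has_hat0 d (P : finPOrderType d) : Prop :=
  exists z : P, forall p : P, (z <= p)%O.

Definition itv_set d (P : finPOrderType d) (a b : P) : {set P} :=
  [set c | (a <= c <= b)%O].

Definition itv_poset d (P : finPOrderType d) (a b : P) : Type :=
  {c : P | c \in itv_set a b}.

Section IntervalPoset.
Variables (d : Order.disp_t) (P : finPOrderType d) (a b : P).
HB.instance Definition _ := SubFinite.on (itv_poset a b).
HB.instance Definition _ := [SubChoice_isSubPOrder of itv_poset a b by <: with d].
End IntervalPoset.

(* An interval is given by its endpoints [a <= b], which are its minimal and
   maximal elements. *)
Definition large_interval d (P : finPOrderType d) (a b : P) : Prop :=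
  [/\ (a <= b)%O, e_of (itv_poset a b) = e_of P &
      forall a' b' : P, (a' <= b')%O -> e_of (itv_poset a' b') = e_of P ->
        itv_set a b \subset itv_set a' b' -> itv_set a' b' = itv_set a b].

(* [a i] and [b i] are the minimal and the maximal element of the interval
   chosen in [P i].  The carrier of [glued a b] is the quotient of the disjoint
   union by the equivalence generated by [b i ~ a (i + 1)].  The construction
   yields a poset for arbitrary points [a i] and [b i]. *)
Section Glue.
Variables (d : Order.disp_t) (k : nat) (P : 'I_k -> finPOrderType d).
Variables (a b : forall i, P i).

Notation S := {i : 'I_k & P i}.

Definition glue_step (u v : S) : bool :=
  [exists i : 'I_k, exists j : 'I_k,
    [&& j == i.+1 :> nat, u == Tagged P (b i) & v == Tagged P (a j)]].

Definition glue_equiv (u v : S) : bool :=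
  connect [rel x y | glue_step x y || glue_step y x] u v.

Lemma glue_equiv_refl : reflexive glue_equiv.
Proof. by move=> u; apply: connect0. Qed.

Lemma glue_equiv_sym : symmetric glue_equiv.
Proof. by apply: sym_connect_sym => u v /=; rewrite orbC. Qed.

Lemma glue_equiv_trans : transitive glue_equiv.
Proof. exact: connect_trans. Qed.

Canonical glue_equiv_rel :=
  EquivRel glue_equiv glue_equiv_refl glue_equiv_sym glue_equiv_trans.

Definition glued : Type := {eq_quot glue_equiv_rel}%qT.

HB.instance Definition _ := Quotient.on glued.
HB.instance Definition _ := Choice.on glued.
HB.instance Definition _ := Countable.on glued.
HB.instance Definition _ : isFinite glued := CanIsFinite (@reprK _ glued).

Definition glue_inj (i : 'I_k) (x : P i) : glued := (\pi_glued (Tagged P x))%qT.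

(* Union of the orders of the [P i]. *)
Definition glued_base (X Y : glued) : bool :=
  [exists i : 'I_k, exists x : P i, exists y : P i,
    [&& (x <= y)%O, X == glue_inj x & Y == glue_inj y]].

Definition glued_le (X Y : glued) : bool := connect glued_base X Y.

(* Explicit form of the preorder on the disjoint union, used for antisymmetry. *)
Let le_expl (u v : S) : bool :=
  [&& (tag u == tag v) ==> (tagged u <= tagged_as u v)%O,
      (tag u < tag v)%N ==>
        [&& (tagged u <= b (tag u))%O, (a (tag v) <= tagged v)%O &
            [forall m : 'I_k, (tag u < m < tag v)%N ==> (a m <= b m)%O]] &
      (tag v < tag u)%N ==>
        [&& (tagged u <= a (tag u))%O, (b (tag v) <= tagged v)%O &
            [forall m : 'I_k, (tag v < m < tag u)%N ==> (b m <= a m)%O]]].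

Let le_expl_refl (u : S) : le_expl u u.
Proof. by case: u => i x; rewrite /le_expl eqxx ltnn tagged_asE lexx. Qed.

Let le_expl_in i (x y : P i) w :
  (x <= y)%O -> le_expl (Tagged P y) w -> le_expl (Tagged P x) w.
Proof.
move=> xy; case/and3P=> /implyP H1 /implyP H2 /implyP H3; apply/and3P; split.
- apply/implyP=> E; move: (H1 E); case: w {H1 H2 H3} E => j z /= /eqP E.
  by subst j; rewrite !tagged_asE; apply: le_trans.
- apply/implyP=> E; have /and3P[h1 -> ->] := H2 E.
  by rewrite !andbT /=; apply: le_trans h1.
- apply/implyP=> E; have /and3P[h1 -> ->] := H3 E.
  by rewrite !andbT /=; apply: le_trans h1.
Qed.

Let le_expl_up (i j : 'I_k) w : j = i.+1 :> nat ->
  le_expl (Tagged P (a j)) w -> le_expl (Tagged P (b i)) w.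
Proof.
case: w => l z ij /and3P[/= /implyP H1 /implyP H2 /implyP H3].
apply/and3P; split; apply/implyP => /= E.
- move/eqP: E => E; subst l; rewrite tagged_asE.
  by have/and3P[] := H3 (eq_leq (esym ij)).
- rewrite lexx /=.
  have [E2|E2|/val_inj E2] := ltngtP j l; last 1 first.
  + subst l; move: (H1 (eqxx _)); rewrite tagged_asE => -> /=.
    by apply/forallP=> m; apply/implyP; lia.
  + have /and3P[h1 -> /forallP h3] := H2 E2; apply/forallP=> m; apply/implyP=> hm.
    case: (eqVneq m j) => [->//|mj]; have := h3 m.
    by move/implyP; apply; move: mj; rewrite -(inj_eq val_inj) /=; lia.
  + by exfalso; move: E; lia.
- have /and3P[h1 -> /forallP h3] : _ := H3 (ltn_trans E (eq_leq (esym ij))).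
  apply/andP; split.
    by move/implyP: (h3 i); apply; lia.
  by apply/forallP=> m; apply/implyP=> hm; move/implyP: (h3 m); apply; lia.
Qed.

Let le_expl_down (i j : 'I_k) w : j = i.+1 :> nat ->
  le_expl (Tagged P (b i)) w -> le_expl (Tagged P (a j)) w.
Proof.
case: w => l z ij /and3P[/= /implyP H1 /implyP H2 /implyP H3].
apply/and3P; split; apply/implyP => /= E.
- move/eqP: E => E; subst l; rewrite tagged_asE.
  by have/and3P[] := H2 (eq_leq (esym ij)).
- have /and3P[h1 -> /forallP h3] : _ := H2 (leq_trans (eq_leq (esym ij)) (ltnW E)).
  apply/andP; split.
    by move/implyP: (h3 j); apply; lia.
  by apply/forallP=> m; apply/implyP=> hm; move/implyP: (h3 m); apply; lia.
- rewrite lexx /=.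
  have [E2|E2|/val_inj E2] := ltngtP l i; last 1 first.
  + subst l; move: (H1 (eqxx _)); rewrite tagged_asE => -> /=.
    by apply/forallP=> m; apply/implyP; lia.
  + have /and3P[h1 -> /forallP h3] := H3 E2; apply/forallP=> m; apply/implyP=> hm.
    case: (eqVneq m i) => [->//|mi]; have := h3 m.
    by move/implyP; apply; move: mi; rewrite -(inj_eq val_inj) /=; lia.
  + by exfalso; move: E; lia.
Qed.

Let le_expl_equiv u v w : glue_equiv u v -> le_expl v w -> le_expl u w.
Proof.
case/connectP=> p; elim: p u => [|x p IH] u /=; first by move=> _ ->.
case/andP=> s /IH{}IH /IH{}IH /IH{}IH.
case/orP: s => /existsP[i /existsP[j /and3P[/eqP ij /eqP Eu /eqP Ex]]]; subst u x.
- exact: le_expl_up ij IH.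
- exact: le_expl_down ij IH.
Qed.

Let le_expl_base X Y w :
  glued_base X Y -> le_expl (repr Y) w -> le_expl (repr X) w.
Proof.
case/existsP=> i /existsP[x /existsP[y /and3P[xy /eqP EX /eqP EY]]] h.
have hx : glue_equiv (repr X) (Tagged P x).
  by rewrite -[glue_equiv _ _]/(glue_equiv_rel _ _); apply/eqmodP; rewrite reprK.
have hy : glue_equiv (Tagged P y) (repr Y).
  by rewrite -[glue_equiv _ _]/(glue_equiv_rel _ _); apply/eqmodP; rewrite reprK.
apply: le_expl_equiv hx _; apply: le_expl_in xy _.
exact: le_expl_equiv hy h.
Qed.

Let glued_le_expl X Y : glued_le X Y -> le_expl (repr X) (repr Y).
Proof.
case/connectP=> p; elim: p X => [|Z p IH] X /=; first by move=> _ ->.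
by case/andP=> s /IH{}IH /IH{}IH; apply: le_expl_base s IH.
Qed.

Let le_expl_chain (i j : 'I_k) : (i < j)%N ->
  (forall m : 'I_k, (i < m < j)%N -> a m = b m) ->
  glue_equiv (Tagged P (b i)) (Tagged P (a j)).
Proof.
move=> ij; move En : (j - i.+1)%N => n; elim: n i ij En => [|n IH] i ij En hm.
  apply: connect1 => /=; apply/orP; left.
  by apply/existsP; exists i; apply/existsP; exists j; rewrite !eqxx !andbT; lia.
have hi : (i.+1 < k)%N by have := ltn_ord j; lia.
pose m := Ordinal hi.
apply: (@glue_equiv_trans (Tagged P (a m))).
  apply: connect1 => /=; apply/orP; left.
  by apply/existsP; exists i; apply/existsP; exists m; rewrite !eqxx.
rewrite (hm m); last by rewrite /m /=; lia.
apply: IH; rewrite /m /=; [lia|lia|].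
by move=> l hl; apply: hm; lia.
Qed.

Let le_expl_anti_lt (u v : S) : (tag u < tag v)%N ->
  le_expl u v -> le_expl v u -> glue_equiv u v.
Proof.
case: u v => [i x] [j y] /= ij /and3P[_ + _] /and3P[_ _] /=.
rewrite ij /= => /and3P[h1 h2 /forallP h3] /and3P[g1 g2 /forallP g3].
have -> : x = b i by apply: le_anti; rewrite h1 g2.
have -> : y = a j by apply: le_anti; rewrite h2 g1.
apply: le_expl_chain => // m hm; apply: le_anti.
by rewrite (implyP (h3 m) hm) (implyP (g3 m) hm).
Qed.

Let le_expl_anti (u v : S) : le_expl u v -> le_expl v u -> glue_equiv u v.
Proof.
move=> h1 h2; case: (ltngtP (tag u) (tag v)) => [uv|vu|/val_inj uv].
- exact: le_expl_anti_lt.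
- by rewrite glue_equiv_sym; apply: le_expl_anti_lt.
case: u v uv h1 h2 => [i x] [j y] /= ij; subst j.
move=> /and3P[+ _ _] /and3P[+ _ _]; rewrite /= eqxx !tagged_asE /= => xy yx.
by have -> : x = y; [apply: le_anti; rewrite xy yx | apply: glue_equiv_refl].
Qed.

Lemma glued_le_refl : reflexive glued_le.
Proof. by move=> X; apply: connect0. Qed.

Lemma glued_le_anti : antisymmetric glued_le.
Proof.
move=> X Y /andP[/glued_le_expl h1 /glued_le_expl h2].
rewrite -[X]reprK -[Y]reprK; apply/eqmodP.
exact: le_expl_anti h1 h2.
Qed.

Lemma glued_le_trans : transitive glued_le.
Proof. exact: connect_trans. Qed.

HB.instance Definition _ := Order.Le_isPOrder.Build d glued
  glued_le_refl glued_le_anti glued_le_trans.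

End Glue.

Lemma e_ofP d (P : finPOrderType d) : (0 < #|P|)%N -> is_e P (e_of P).
Proof.
move=> P0; rewrite /e_of; apply: xgetPex.
have free0 : levels_free P 0.
  move=> n s [f [_ fF _]]; case/card_gt0P: P0 => x _.
  by have := fF x; rewrite /levels big_ord0 inE.
have bound k : levels_free P k -> (k <= #|P|)%N.
  move=> Pk; rewrite leqNgt; apply/negP => Pltk.
  apply: (Pk #|P| 1); pose g (u : P) := [set enum_rank v | v in [set v | (v <= u)%O]].
  have gS u v : (g u \subset g v) = (u <= v)%O.
    apply/idP/idP => [/subsetP/(_ (enum_rank u))|uv].
      rewrite !mem_imset ?inE ?lexx; [exact | exact: enum_rank_inj..].
    by apply: imsetS; apply/subsetP=> w; rewrite !inE => /le_trans; apply.
  exists g; split=> [u v guv|u|u v uv]; last by rewrite gS.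
    by apply: le_anti; rewrite -!gS guv subxx.
  have gpos : (0 < #|g u|)%N.
    by apply/card_gt0P; exists (enum_rank u); rewrite mem_imset ?inE //; exact: enum_rank_inj.
  have gle : (#|g u| <= #|P|)%N by rewrite -[X in (_ <= X)%N]card_ord max_card.
  have lt : (#|g u|.-1 < k)%N by lia.
  by apply/bigcupP; exists (Ordinal lt) => //; rewrite inE /= -[1]/(1%:Z) -PoszD add1n prednK.
have ex0 : exists k, `[< levels_free P k >] by exists 0%N; apply/asboolP.
have ub k : `[< levels_free P k >] -> (k <= #|P|)%N by move=> /asboolP /bound.
have [m /asboolP Pm mmax] := ex_maxnP ex0 ub.
by exists m; split=> // k Pk; apply: mmax; apply/asboolP.
Qed.

Section LubellFormula.
Variable n : nat.
Implicit Types (A B X : {set 'I_n}) (C : {set {set 'I_n}}).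

Let chain_cmp C A B : chain C -> A \in C -> B \in C -> (A \subset B) || (B \subset A).
Proof. by move=> /forall_inP h /h /forall_inP; apply. Qed.

Let chain_card C A B : chain C -> A \in C -> B \in C -> (#|A| <= #|B|)%N -> A \subset B.
Proof.
move=> hC hA hB le; have /orP[//|BA] := chain_cmp hC hA hB.
by have /eqP -> : B == A by rewrite eqEcard BA.
Qed.

Let subset_between A B j : A \subset B -> (#|A| <= j <= #|B|)%N ->
  exists X, [/\ A \subset X, X \subset B & #|X| = j].
Proof.
move En: (j - #|A|)%N => m; elim: m A En => [|m IH] A En AB /andP[Aj jB].
  by exists A; split=> //; lia.
have /properP[_ [x xB xA]] : A \proper B by rewrite properEcard AB; lia.
have cA : #|x |: A| = #|A|.+1 by rewrite cardsU1 xA.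
have [|||X [h1 h2 h3]] := IH (x |: A).
- by rewrite cA; lia.
- by rewrite subUset sub1set xB.
- by rewrite cA; lia.
by exists X; split=> //; apply: subset_trans h1; apply: subsetUr.
Qed.

Let full_chain_level C j : C \in full_chains n -> (j <= n)%N ->
  exists2 X, X \in C & #|X| = j.
Proof.
rewrite inE => /maxsetP[hC Cmax] jn.
pose L := (\bigcup_(A in C | (#|A| <= j)%N) A).
pose U := (\bigcap_(A in C | (j <= #|A|)%N) A).
have cL : (#|L| <= j)%N.
  suff /andP[] : (#|L| <= j)%N && ((L \in C) || (L == set0)) by [].
  rewrite /L; apply: (big_ind (fun Z : {set 'I_n} => (#|Z| <= j)%N && ((Z \in C) || (Z == set0)))) => [|X Y /andP[X1 X2] /andP[Y1 Y2]|X /andP[XC ->]].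
  - by rewrite cards0 eqxx orbT.
  - case/orP: X2 => [X2|/eqP ->]; last by rewrite set0U Y1 Y2.
    case/orP: Y2 => [Y2|/eqP ->]; last by rewrite setU0 X1 X2.
    case/orP: (chain_cmp hC X2 Y2) => [/setUidPr ->|/setUidPl ->].
      by rewrite Y1 Y2.
    by rewrite X1 X2.
  - by rewrite XC.
have cU : (j <= #|U|)%N.
  suff /andP[] : (j <= #|U|)%N && ((U \in C) || (U == [set: 'I_n])) by [].
  rewrite /U; apply: (big_ind (fun Z : {set 'I_n} => (j <= #|Z|)%N && ((Z \in C) || (Z == [set: 'I_n])))) => [|X Y /andP[X1 X2] /andP[Y1 Y2]|X /andP[XC ->]].
  - by rewrite cardsT card_ord eqxx orbT jn.
  - case/orP: X2 => [X2|/eqP ->]; last by rewrite setTI Y1 Y2.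
    case/orP: Y2 => [Y2|/eqP ->]; last by rewrite setIT X1 X2.
    case/orP: (chain_cmp hC X2 Y2) => [/setIidPl ->|/setIidPr ->].
      by rewrite X1 X2.
    by rewrite Y1 Y2.
  - by rewrite XC.
have LU : L \subset U.
  apply/bigcupsP => A /andP[AC Aj]; apply/bigcapsP => B /andP[BC jB].
  by apply: chain_card hC AC BC (leq_trans Aj jB).
have [X [LX XU cX]] : exists X, [/\ L \subset X, X \subset U & #|X| = j].
  by apply: subset_between LU _; rewrite cL cU.
have cmp A : A \in C -> (A \subset X) || (X \subset A).
  move=> AC; case: (leqP #|A| j) => Aj.
    by apply/orP; left; apply: subset_trans LX; apply: bigcup_sup; rewrite AC Aj.
  apply/orP; right; apply: subset_trans XU _; apply: bigcap_inf.
  by rewrite AC ltnW.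
exists X => //; suff <- : X |: C = C by rewrite setU11.
apply: Cmax; last exact: subsetUr.
apply/forall_inP=> A /setU1P[->|AC]; apply/forall_inP=> B /setU1P[->|BC].
- by rewrite subxx.
- by rewrite orbC cmp.
- exact: cmp.
- exact: chain_cmp hC AC BC.
Qed.

Let full_chain_level1 C j : C \in full_chains n -> (j <= n)%N ->
  #|[set A in C | #|A| == j]| = 1%N.
Proof.
move=> hC jn; have [X XC cX] := full_chain_level hC jn.
apply/eqP/cards1P; exists X; apply/setP=> A; rewrite !inE.
apply/andP/eqP => [[AC /eqP cA]|->]; last by rewrite XC cX.
move: hC; rewrite inE => /maxsetp hC.
by apply/eqP; rewrite eqEsubset !(chain_card hC) // cA cX.
Qed.

Let Nch A := #|[set C in full_chains n | A \in C]|.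

Let permS (s : {perm 'I_n}) C : {set {set 'I_n}} := [set s @: (A : {set 'I_n}) | A in C].

Let permSK (s t : {perm 'I_n}) C : (forall x, t (s x) = x) -> permS t (permS s C) = C.
Proof.
move=> st; rewrite /permS -imset_comp -[RHS]imset_id.
apply: eq_imset => A /=; rewrite -imset_comp -[RHS]imset_id.
by apply: eq_imset => x /=; rewrite st.
Qed.

Let chain_permS s C : chain C -> chain (permS s C).
Proof.
move=> hC; apply/forall_inP=> _ /imsetP[A AC ->]; apply/forall_inP=> _ /imsetP[B BC ->].
by case/orP: (chain_cmp hC AC BC) => h; apply/orP; [left|right]; apply: imsetS.
Qed.

Let full_permS s C : C \in full_chains n -> permS s C \in full_chains n.
Proof.
rewrite !inE => /maxsetP[hC Cmax]; apply/maxsetP; split; first exact: chain_permS.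
have sK x : (s^-1)%g (s x) = x by rewrite permK.
have Ks x : s ((s^-1)%g x) = x by rewrite permKV.
move=> D hD CD; rewrite -(Cmax (permS s^-1%g D)) ?(permSK _ Ks) //.
  exact: chain_permS.
by rewrite -{1}(permSK C sK); apply: imsetS.
Qed.

Let Nch_perm (s : {perm 'I_n}) A : (Nch A <= Nch (s @: A))%N.
Proof.
have sK x : (s^-1)%g (s x) = x by rewrite permK.
have <- : #|[set permS s C | C : {set {set 'I_n}} in [set C in full_chains n | A \in C]]| = Nch A.
  exact: card_imset (can_inj (fun C => permSK C sK)).
apply: subset_leq_card; apply/subsetP=> _ /imsetP[C + ->].
by rewrite inE => /andP[hC AC]; rewrite inE full_permS //=; apply: imset_f.
Qed.

Let perm_card A B : #|A| = #|B| -> exists s : {perm 'I_n}, s @: A = B.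
Proof.
move=> cAB.
pose e (D : {set 'I_n}) := enum D ++ enum (~: D).
have e_uniq D : uniq (e D).
  rewrite cat_uniq !enum_uniq andbT /=; apply/hasPn=> x.
  by rewrite !mem_enum inE.
have e_mem D x : x \in e D by rewrite mem_cat !mem_enum inE orbN.
have e_size D : size (e D) = n by rewrite size_cat -!cardE cardsC card_ord.
pose f x := nth x (e B) (index x (e A)).
have f_inj : injective f.
  have lt x : (index x (e A) < size (e B))%N by rewrite e_size -[X in (_ < X)%N](e_size A) index_mem.
  move=> x y; rewrite /f (set_nth_default y) //.
  by move/eqP; rewrite nth_uniq // => /eqP; apply: index_inj.
exists (perm f_inj); apply/eqP; rewrite eqEcard card_imset ?cAB ?leqnn ?andbT; last exact: perm_inj.
apply/subsetP=> _ /imsetP[x xA ->]; rewrite permE /f.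
have lt : (index x (e A) < size (enum B))%N.
  by rewrite -cardE -cAB cardE index_cat mem_enum xA index_mem mem_enum.
by rewrite nth_cat lt -mem_enum mem_nth.
Qed.

Let Nch_card A B : #|A| = #|B| -> Nch A = Nch B.
Proof.
move=> cAB; apply/eqP; rewrite eqn_leq; apply/andP; split.
  by have [s <-] := perm_card cAB; apply: Nch_perm.
by have [s <-] := perm_card (esym cAB); apply: Nch_perm.
Qed.

Let sum_Nch (Q : pred {set 'I_n}) :
  (\sum_(A | Q A) Nch A = \sum_(C in full_chains n) #|[set A in C | Q A]|)%N.
Proof.
transitivity (\sum_(A | Q A) \sum_(C in full_chains n) (A \in C : nat))%N.
  apply: eq_bigr => A _; rewrite /Nch -sum1_card big_mkcond [RHS]big_mkcond.
  by apply: eq_bigr => C _; rewrite inE; case: ifP; case: (C \in _); case: (A \in _).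
rewrite exchange_big /=; apply: eq_bigr => C _.
rewrite -sum1_card big_mkcond [RHS]big_mkcond.
by apply: eq_bigr => A _; rewrite inE; case: (Q A); case: (A \in C).
Qed.

Let Nch_bin A : ('C(n, #|A|) * Nch A = #|full_chains n|)%N.
Proof.
have cA : (#|A| <= n)%N by rewrite -[X in (_ <= X)%N]card_ord max_card.
have := sum_Nch [pred B : {set 'I_n} | #|B| == #|A|].
under [in RHS]eq_bigr => C hC do rewrite (full_chain_level1 hC cA).
rewrite sum1_card => <-.
rewrite (eq_bigr (fun=> Nch A)) => [|B /eqP /Nch_card //].
rewrite sum_nat_const; congr (_ * _)%N.
by rewrite -[n in 'C(n, _)]card_ord -card_draws; apply: eq_card => B; rewrite !inE.
Qed.

Let full_chains_gt0 : (0 < #|full_chains n|)%N.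
Proof.
have [|C hC _] := @maxset_exists _ (@chain n) set0.
  by apply/forall_inP=> A; rewrite inE.
by apply/card_gt0P; exists C; rewrite inE.
Qed.

Lemma lubellE (R : realType) (F : {set {set 'I_n}}) :
  lubell R F = \sum_(A in F) ('C(n, #|A|)%:R)^-1.
Proof.
rewrite /lubell -natr_sum.
have -> : (\sum_(C in full_chains n) #|F :&: C| = \sum_(A in F) Nch A)%N.
  rewrite sum_Nch; apply: eq_bigr => C _; congr #|pred_of_set _|.
  by apply/setP=> A; rewrite !inE andbC.
rewrite natr_sum mulr_suml; apply: eq_bigr => A _.
rewrite -(Nch_bin A) natrM invfM mulrCA mulfV ?mulr1 // pnatr_eq0 -lt0n.
by have := full_chains_gt0; rewrite -(Nch_bin A) muln_gt0 => /andP[].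
Qed.

End LubellFormula.

(* Main.v *)
Require Import Defs.
From mathcomp Require Import boolp classical_sets reals.
From mathcomp Require Import all_boot all_order all_algebra.
From mathcomp Require Import zify lra.

(* Maximality of the large intervals makes each [a i] the bottom of [P i], so
   every [P i] is glued by its bottom element; comparing levels gives
   e(P) >= e(P_1) + ... + e(P_k).  Given a family [F], peel from the top: keep
   the sets A of the current family above which it contains a copy of [P i]
   with bottom A, even after deleting any bounded number of other sets.  For a
   discarded A the interval [A, [n]] contains an essentially [P i]-free family
   (up to boundedly many sets, each of weight O(1/n)), so by the lower-L-bound
   its Lubell function is at most e(P_i) + eps, and conditioning on the lowest
   member of a chain extends this bound to the whole discarded family.  If
   something survived all k peelings, the copies of the [P i] could be stacked
   disjointly into a copy of the glued poset. *)

Set Implicit Arguments.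
Unset Strict Implicit.
Unset Printing Implicit Defensive.

Import Order.TTheory GRing.Theory Num.Theory.

Local Open Scope ring_scope.

(** * Levels, monotonicity of [e_of], and large intervals *)

Lemma in_levels n (s : int) (k : nat) (A : {set 'I_n}) :
  (A \in levels n s k) = (s <= #|A|%:Z < s + k%:Z).
Proof.
apply/bigcupP/idP => [[j _]|h]; first by rewrite inE => /eqP ->; have := ltn_ord j; lia.
have hj : (absz (#|A|%:Z - s) < k)%N by lia.
by exists (Ordinal hj) => //; rewrite inE /= gez0_abs ?subr_ge0 ?(andP h).1 // subrKC.
Qed.

Lemma e_of_le d d' (Q : finPOrderType d) (P : finPOrderType d') (f : Q -> P) :
  (0 < #|Q|)%N -> injective f -> {homo f : x y / (x <= y)%O} ->
  (e_of Q <= e_of P)%N.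
Proof.
move=> Q0 finj fmono; have [Qfree _] := e_ofP Q0.
have P0 : (0 < #|P|)%N.
  by case/card_gt0P: Q0 => x _; apply/card_gt0P; exists (f x).
have [_ Pmax] := e_ofP P0; apply: Pmax => n s [g [ginj gF gmono]].
apply: (Qfree n s); exists (g \o f); split=> [|x|x y xy] /=.
- exact: inj_comp.
- exact: gF.
- exact/gmono/fmono.
Qed.

Lemma card_itv_gt0 d (P : finPOrderType d) (a b : P) :
  (a <= b)%O -> (0 < #|{: itv_poset a b}|)%N.
Proof.
move=> ab; have ain : a \in itv_set a b by rewrite inE lexx.
by apply/card_gt0P; exists (Sub a ain).
Qed.

(* Enlarging [a, b] downwards to [0, b] cannot change [e], so maximality
   forces [a] to be the bottom element. *)
Lemma large_interval_hat0 d (P : finPOrderType d) (a b : P) :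
  has_hat0 P -> large_interval a b -> forall x : P, (a <= x)%O.
Proof.
move=> [z zmin] [ab eab maxab] x; apply: le_trans (zmin x).
have sub : itv_set a b \subset itv_set z b.
  by apply/subsetP=> c; rewrite !inE zmin => /andP[].
have le1 : (e_of (itv_poset a b) <= e_of (itv_poset z b))%N.
  have f_in (u : itv_poset a b) : val u \in itv_set z b by apply: (subsetP sub); exact: valP.
  pose f (u : itv_poset a b) : itv_poset z b := Sub (val u) (f_in u).
  apply: (@e_of_le _ _ (itv_poset a b) (itv_poset z b) f).
  - exact: card_itv_gt0.
  - by move=> u v /(congr1 val) /= /val_inj.
  - by [].
have le2 : (e_of (itv_poset z b) <= e_of P)%N.
  apply: (@e_of_le _ _ (itv_poset z b) P val) => //; last exact: val_inj.
  exact: card_itv_gt0.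
have : z \in itv_set z b by rewrite inE lexx zmin.
rewrite (maxab z b) //; first by rewrite inE => /andP[].
by apply/eqP; rewrite eqn_leq le2 -eab.
Qed.

(** * Maps into and out of the glued poset, and a lower bound on its [e_of] *)

Section GluedPoset.
Variables (d : Order.disp_t) (k : nat) (P : 'I_k -> finPOrderType d).
Variables (a b : forall i, P i).

Notation S := {i : 'I_k & P i}.

(* Retraction of the glued poset onto [P i]: it collapses the earlier posets
   to [a i] and the later ones to [b i]. *)
Definition retract (i : 'I_k) (u : S) : P i :=
  if (tag u < i)%N then a i else
  if tag u =P i is ReflectT e then ecast j (P j) e (tagged u) else b i.

Lemma retract_Tagged i (x : P i) : retract i (Tagged P x) = x.
Proof. by rewrite /retract ltnn /=; case: eqP => // e; rewrite eq_axiomK. Qed.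

Lemma retract_lt (i : 'I_k) (u : S) : (tag u < i)%N -> retract i u = a i.
Proof. by rewrite /retract => ->. Qed.

Lemma retract_gt (i : 'I_k) (u : S) : (i < tag u)%N -> retract i u = b i.
Proof.
move=> iu; rewrite /retract ltnNge (ltnW iu) /=; case: eqP => // e.
by exfalso; move: iu; rewrite e ltnn.
Qed.

Lemma retract_step i u v : glue_step a b u v -> retract i u = retract i v.
Proof.
case/existsP=> m /existsP[l /and3P[/eqP lm /eqP -> /eqP ->]].
have [mi|im|/val_inj mi] := ltngtP m i; last first.
- by subst i; rewrite retract_Tagged retract_gt //= lm.
- by rewrite !retract_gt //= lm ltnS ltnW.
have [li|il|/val_inj li] := ltngtP l i.
- by rewrite !retract_lt.
- by move: il; rewrite lm ltnS leqNgt mi.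
- by subst i; rewrite retract_Tagged retract_lt.
Qed.

Lemma retract_equiv i u v : glue_equiv a b u v -> retract i u = retract i v.
Proof.
case/connectP=> p; elim: p u => [|x p IH] u /=; first by move=> _ ->.
by case/andP=> /orP[]/(retract_step i) + /IH{}IH /IH <- => ->.
Qed.

Lemma glue_injE i j (x : P i) (y : P j) :
  (glue_inj a b x == glue_inj a b y) = glue_equiv a b (Tagged P x) (Tagged P y).
Proof. by rewrite -[RHS]/(glue_equiv_rel a b _ _); apply/eqP/eqmodP. Qed.

(** [retract i] is constant on glueing classes and restricts to the identity on [P i]. *)
Lemma glue_inj_injective i : injective (@glue_inj _ _ P a b i).
Proof.
move=> x y /eqP; rewrite glue_injE => /(retract_equiv i).
by rewrite !retract_Tagged.
Qed.

Lemma glue_inj_homo i : {homo @glue_inj _ _ P a b i : x y / (x <= y)%O}.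
Proof.
move=> x y xy; apply: connect1; apply/existsP; exists i.
by apply/existsP; exists x; apply/existsP; exists y; rewrite xy !eqxx.
Qed.

Lemma glue_equiv_step (i j : 'I_k) : j = i.+1 :> nat ->
  glue_equiv a b (Tagged P (b i)) (Tagged P (a j)).
Proof.
move=> ij; apply: connect1; apply/orP; left.
by apply/existsP; exists i; apply/existsP; exists j; rewrite ij !eqxx.
Qed.

(** Agreement at the glueing points lets the maps descend to the quotient; they stay monotone
    because [glued_le] is generated by the orders of the pieces. *)
Lemma glued_subposet n (F : {set {set 'I_n}}) (h : forall i, P i -> {set 'I_n}) :
  (forall i x, h i x \in F) ->
  (forall i, {homo h i : x y / (x <= y)%O >-> x \subset y}) ->
  (forall i j : 'I_k, j = i.+1 :> nat -> h i (b i) = h j (a j)) ->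
  (forall i j x y, h i x = h j y -> glue_equiv a b (Tagged P x) (Tagged P y)) ->
  subposet_of (glued a b) F.
Proof.
move=> hF hmono hglue hinj; pose f (u : S) := h (tag u) (tagged u).
have fstep u v : glue_step a b u v -> f u = f v.
  by case/existsP=> i /existsP[j /and3P[/eqP ij /eqP -> /eqP ->]]; apply: hglue.
have fequiv u v : glue_equiv a b u v -> f u = f v.
  case/connectP=> p; elim: p u => [|x p IH] u /=; first by move=> _ ->.
  by case/andP=> /orP[]/fstep + /IH{}IH /IH <- => ->.
have frepr i (x : P i) : f (repr (glue_inj a b x)) = h i x.
  rewrite -[RHS]/(f (Tagged P x)); apply: fequiv.
  by rewrite -[glue_equiv _ _ _ _]/(glue_equiv_rel a b _ _); apply/eqmodP; rewrite reprK.
exists (fun X => f (repr X)); split=> [X Y|X|X Y].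
- move=> /hinj; rewrite -/(glue_equiv _ _ _ _) !taggedK => e.
  rewrite -[X]reprK -[Y]reprK; apply/eqmodP.
  exact: e.
- exact: hF.
- case/connectP=> p; elim: p X => [|Z p IH] X /=; first by move=> _ ->.
  case/andP=> s /IH{}IH /IH; apply: subset_trans.
  case/existsP: s => i /existsP[x /existsP[y /and3P[xy /eqP -> /eqP ->]]].
  by rewrite !frepr; apply: hmono.
Qed.

(** In a copy inside consecutive levels each chosen interval climbs by at least [e_of (P i)], and
    the glueing makes these climbs add up. *)
Lemma e_of_glued : (0 < k)%N ->
  (forall i, (a i <= b i)%O) -> (forall i, e_of (itv_poset (a i) (b i)) = e_of (P i)) ->
  (\sum_i e_of (P i) <= e_of (glued a b))%N.
Proof.
move=> k0 hab hI; pose i0 := Ordinal k0.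
have G0 : (0 < #|{: glued a b}|)%N by apply/card_gt0P; exists (glue_inj a b (a i0)).
have [_ Gmax] := e_ofP G0; apply: Gmax => n s [g [ginj gF gmono]].
(* Indices beyond ['I_k] get weight 0, so that the partial sums run over the naturals. *)
pose w (i : nat) := if insub i is Some o then e_of (P o) else 0%N.
have wE (i : 'I_k) : w i = e_of (P i) by rewrite /w valK.
pose W (j : nat) := (\sum_(0 <= i < j) w i)%N.
have WE : (\sum_i e_of (P i) = W k)%N.
  by rewrite /W big_mkord; apply: eq_bigr => i _; rewrite wE.
have W0 : W 0%N = 0%N by rewrite /W big_geq.
have WS j : W j.+1 = (W j + w j)%N by rewrite /W big_nat_recr.
rewrite WE in gF *.
(* If [b i] lay below the bound, the interval of [P i] would fit into
   [e_of (P i)] consecutive levels. *)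
have up (i : 'I_k) : s + (W i)%:Z <= #|g (glue_inj a b (a i))|%:Z ->
    s + (W i.+1)%:Z <= #|g (glue_inj a b (b i))|%:Z.
  move=> lo; rewrite leNgt; apply/negP => hi.
  have [free _] := e_ofP (card_itv_gt0 (hab i)).
  apply: (free n (s + (W i)%:Z)); exists (fun u => g (glue_inj a b (val u))); split.
  - by move=> u v /ginj /glue_inj_injective /val_inj.
  - move=> u; have := valP u; rewrite inE => /andP[au ub].
    have cl := subset_leq_card (gmono _ _ (glue_inj_homo au)).
    have cu := subset_leq_card (gmono _ _ (glue_inj_homo ub)).
    rewrite in_levels hI -wE -addrA -PoszD -WS.
    by rewrite (le_trans lo) ?lez_nat // (le_lt_trans _ hi) ?lez_nat.
  - by move=> u v uv; apply/gmono/glue_inj_homo.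
have key (j : nat) (jk : (j < k)%N) :
    s + (W j.+1)%:Z <= #|g (glue_inj a b (b (Ordinal jk)))|%:Z.
  elim: j jk => [|j IH] jk; apply: (up (Ordinal jk)) => /=.
    have := gF (glue_inj a b (a (Ordinal jk))).
    by rewrite in_levels W0 addr0 => /andP[].
  have /eqP <- : glue_inj a b (b (Ordinal (ltnW jk))) == glue_inj a b (a (Ordinal jk)).
    by rewrite glue_injE; apply: glue_equiv_step.
  exact: IH.
(* The top of the last interval would lie at level at least [s + W k], just past the allowed
   levels. *)
have kk : (k.-1 < k)%N by lia.
have := gF (glue_inj a b (b (Ordinal kk))); have := key _ kk.
by rewrite in_levels prednK //; lia.
Qed.

End GluedPoset.

(** * Lubell functions on the intervals from [A] to the full set *)

Section UpLubell.
Variables (R : realType) (n : nat).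
Implicit Types (A B : {set 'I_n}) (F G : {set {set 'I_n}}).

(* Lubell function of the part of [F] in the interval [A, [n]]. *)
Definition up_lubell A F : R :=
  \sum_(B in F | A \subset B) ('C(n - #|A|, #|B| - #|A|)%:R)^-1.

Lemma up_lubell0 F : up_lubell set0 F = lubell R F.
Proof.
rewrite lubellE; apply: eq_big => [B|B _]; first by rewrite sub0set andbT.
by rewrite cards0 !subn0.
Qed.

Lemma up_lubell_sub A F G : F \subset G -> up_lubell A F <= up_lubell A G.
Proof.
move=> /subsetP FG; rewrite /up_lubell [X in X <= _]big_mkcond [X in _ <= X]big_mkcond.
apply: ler_sum => B _; case: ifP => [/andP[/FG -> ->] //|_].
by case: ifP; rewrite // invr_ge0.
Qed.

Lemma inv_bin_diag (m t : nat) : (t < m)%N ->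
  m%:R * ('C(m, t.+1)%:R)^-1 = t.+1%:R * ('C(m.-1, t)%:R)^-1 :> R.
Proof.
move=> tm; have h1 : 'C(m, t.+1)%:R != 0 :> R by rewrite pnatr_eq0 -lt0n bin_gt0.
have h2 : 'C(m.-1, t)%:R != 0 :> R by rewrite pnatr_eq0 -lt0n bin_gt0; lia.
by apply/eqP; rewrite eqr_div // -!natrM mul_bin_diag.
Qed.

(** Double counting of the pairs [(x, B)] with [x] in [B :\: A]; [inv_bin_diag] converts the
    weights. *)
Lemma up_lubell_avg A F : A \notin F ->
  (n - #|A|)%:R * up_lubell A F = \sum_(x | x \notin A) up_lubell (x |: A) F.
Proof.
move=> AF; rewrite /up_lubell.
rewrite (exchange_big_dep [pred B | (B \in F) && (A \subset B)]) /=; last first.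
  by move=> x B _ /andP[->]; rewrite subUset => /andP[_ ->].
rewrite mulr_sumr; apply: eq_bigr => B /andP[BF AB].
have AltB : (#|A| < #|B|)%N.
  apply: proper_card; rewrite properEneq AB andbT.
  by apply: contraNneq AF => ->.
have Bn : (#|B| <= n)%N by rewrite -[X in (_ <= X)%N]card_ord max_card.
rewrite (eq_bigl [in B :\: A]); last first.
  by move=> x; rewrite !inE BF subUset AB sub1set andbT.
rewrite (eq_bigr (fun=> ('C((n - #|A|).-1, (#|B| - #|A|).-1)%:R)^-1)); last first.
  move=> x; rewrite inE => /andP[xA _]; rewrite cardsU1 xA add1n.
  by rewrite !subnS.
have [t Et] : exists t, (#|B| - #|A| = t.+1)%N by exists (#|B| - #|A|).-1; lia.
by rewrite sumr_const cardsDS // -[RHS]mulr_natl Et inv_bin_diag // -Et leq_sub2r.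
Qed.

(* If [A] is not in [F], then [up_lubell A F] is an average of values at the
   upper covers of [A]. *)
Lemma up_lubell_le (c : R) F : 0 <= c ->
  (forall A, A \in F -> up_lubell A F <= c) -> forall A, up_lubell A F <= c.
Proof.
move=> c0 hF A; move Em : (n - #|A|)%N => m; elim: m A Em => [|m IH] A Em.
  (* Here [A] is the full set, so the sum is empty when [A] is not in [F]. *)
  have [|AF] := boolP (A \in F); first exact: hF.
  rewrite /up_lubell big1 // => B /andP[BF AB].
  suff AB' : A == B by rewrite -(eqP AB') (negbTE AF) in BF.
  rewrite eqEcard AB (leq_trans (n := n)) //; last by lia.
  by rewrite -[X in (_ <= X)%N]card_ord max_card.
have [|AF] := boolP (A \in F); first exact: hF.
have m0 : (0 : R) < m.+1%:R by rewrite ltr0n.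
rewrite -(ler_pM2l m0) -Em up_lubell_avg // Em.
have -> : m.+1%:R * c = \sum_(x | x \notin A) c.
  rewrite (eq_bigl [in ~: A]) => [|x]; last by rewrite inE.
  by rewrite sumr_const mulr_natl cardsCs setCK card_ord Em.
apply: ler_sum => x xA; apply: IH; rewrite cardsU1 xA; lia.
Qed.

End UpLubell.

(** * The interval above [A] as a smaller Boolean lattice *)

Section UpInterval.
Variables (n : nat) (A : {set 'I_n}).

(** The complement of [A] is enumerated by an ordinal because [lower_L_bounded] speaks of subsets of
    some ['I_n]. *)
Definition up_set (D : {set 'I_#|~: A|}) : {set 'I_n} := A :|: (enum_val @: D).

Lemma up_setS (D E : {set 'I_#|~: A|}) : D \subset E -> up_set D \subset up_set E.
Proof. by move=> DE; apply/setUS/imsetS. Qed.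

Lemma card_up_set (D : {set 'I_#|~: A|}) : #|up_set D| = (#|A| + #|D|)%N.
Proof.
have AD : A :&: (enum_val @: D) = set0.
  apply/setP=> x; rewrite !inE; apply/negP=> /andP[xA /imsetP[i _ xi]].
  by have := enum_valP i; rewrite -xi inE xA.
by rewrite /up_set cardsU AD cards0 subn0 card_imset //; apply: enum_val_inj.
Qed.

Lemma up_setK : cancel up_set (fun B => [set i | enum_val i \in B]).
Proof.
move=> D; apply/setP=> i; rewrite !inE mem_imset; last exact: enum_val_inj.
by have := enum_valP i; rewrite inE => /negbTE ->.
Qed.

Lemma up_setKV (B : {set 'I_n}) : A \subset B -> up_set [set i | enum_val i \in B] = B.
Proof.
move=> /subsetP AB; apply/setP=> x; rewrite inE.
have [/AB -> //|xA /=] := boolP (x \in A).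
have xC : x \in ~: A by rewrite inE.
rewrite -(enum_rankK_in xC xC) mem_imset ?inE //; exact: enum_val_inj.
Qed.

Lemma lubell_up_set (R : realType) (F : {set {set 'I_n}}) :
  lubell R [set D | up_set D \in F] = up_lubell R A F.
Proof.
rewrite lubellE /up_lubell.
rewrite (reindex_onto up_set (fun B => [set i | enum_val i \in B])); last first.
  by move=> B /andP[_]; apply: up_setKV.
apply: eq_big => [D|D _]; first by rewrite inE up_setK eqxx andbT subsetUl andbT.
rewrite card_up_set addKn; congr ('C(_, _)%:R)^-1.
by rewrite cardsCs setCK card_ord.
Qed.

End UpInterval.

(* Relative sizes do not grow when passing from [2^[n]] to the interval
   [A, [n]], so a lower-L-bound transfers to it. *)
Lemma up_lubell_free (R : realType) d (P : finPOrderType d) (beta c : R) (N : nat) :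
  beta <= 1 ->
  (forall n, (N <= n)%N -> forall F : {set {set 'I_n}}, poset_free P F ->
     (forall A, A \in F -> #|A|%:R < beta * n%:R) -> lubell R F <= c) ->
  forall n (A : {set 'I_n}) (F : {set {set 'I_n}}), (N <= n - #|A|)%N ->
    poset_free P [set B in F | A \subset B] ->
    (forall B, B \in F -> #|B|%:R < beta * n%:R) -> up_lubell R A F <= c.
Proof.
move=> b1 hN n A F NA Ffree Fsize; rewrite -lubell_up_set.
have cA : (#|~: A| = n - #|A|)%N by rewrite cardsCs setCK card_ord.
have An : (#|A| <= n)%N by rewrite -[X in (_ <= X)%N]card_ord max_card.
apply: hN; first by rewrite cA.
- move=> [f [finj fF fmono]]; apply: Ffree; exists (fun x => up_set (f x)); split.
  + by move=> x y /(can_inj (@up_setK _ _)) /finj.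
  + by move=> x; have := fF x; rewrite !inE subsetUl andbT.
  + by move=> x y /fmono; apply: up_setS.
- move=> D; rewrite inE => /Fsize; rewrite card_up_set natrD.
  have -> : #|~: A|%:R = n%:R - #|A|%:R :> R by rewrite cA natrB.
  (* With this slack [#|A| + #|D| < beta * n] gives [#|D| < beta * (n - #|A|)]. *)
  have : 0 <= (1 - beta) * #|A|%:R :> R by rewrite mulr_ge0 // subr_ge0.
  by lra.
Qed.

(** Bounds by [1 / m] the weight of a set strictly inside an interval of rank [m]. *)
Lemma leq_bin_id (m j : nat) : (0 < j < m)%N -> (m <= 'C(m, j))%N.
Proof.
elim: m j => [|m IH] [|[|j]] // jm; first by rewrite bin1.
rewrite binS; have := IH j.+1; have : (0 < 'C(m, j.+2))%N by rewrite bin_gt0; lia.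
lia.
Qed.

(** * Roots of robust copies, and the Lubell function of the non-roots *)

Section Roots.
Variables (d : Order.disp_t) (P : finPOrderType d) (a : P) (M n : nat).

Definition rooted_at (F : {set {set 'I_n}}) (A : {set 'I_n}) : Prop :=
  forall Z : {set {set 'I_n}}, A \notin Z -> (#|Z| <= M)%N ->
  exists g : P -> {set 'I_n},
    [/\ injective g, forall x, g x \in F :\: Z,
        {homo g : x y / (x <= y)%O >-> x \subset y} & g a = A].

(* Members of [F] from which a copy of [P] rises that can moreover avoid any
   prescribed [M] other sets. *)
Definition roots (F : {set {set 'I_n}}) : {set {set 'I_n}} :=
  [set A in F | `[< rooted_at F A >]].

Lemma roots_sub F : roots F \subset F.
Proof. by apply/subsetP=> A; rewrite inE => /andP[]. Qed.

End Roots.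

Lemma lubell_setD_roots (R : realType) d (P : finPOrderType d) (a : P) (M : nat)
    (beta eps : R) :
  (forall x : P, (a <= x)%O) -> lower_L_bounded R P ->
  2^-1 < beta < 1 -> 0 < eps ->
  exists N : nat, forall n : nat, (N <= n)%N -> forall F : {set {set 'I_n}},
    (forall A, A \in F -> #|A|%:R < beta * n%:R) ->
    lubell R (F :\: roots a M F) <= (e_of P)%:R + eps.
Proof.
move=> amin hP hbeta eps0; have [b0 b1] := andP hbeta.
have eps20 : 0 < eps / 2 by rewrite divr_gt0.
have [N0 hN0] := hP beta (eps / 2) hbeta eps20.
have ob : 0 < 1 - beta by rewrite subr_gt0.
(* As sets in [F] have size below [beta * n], this makes [n - #|A|] exceed [N0 + M / (eps / 2)]: at
   least [N0], and large enough for [M] weights [1 / (n - #|A|)] to sum to at most [eps / 2]. *)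
exists (Num.trunc ((N0%:R + M%:R / (eps / 2)) / (1 - beta))).+1 => n hn F Fsize.
have Mpos : 0 <= M%:R / (eps / 2) by rewrite divr_ge0 // ltW.
have nlarge : N0%:R + M%:R / (eps / 2) < (1 - beta) * n%:R.
  rewrite [X in _ < X]mulrC -ltr_pdivrMr //; apply: lt_le_trans (truncnS_gt _) _.
  by rewrite ler_nat.
have c0 : 0 <= (e_of P)%:R + eps :> R by rewrite addr_ge0 // ltW.
rewrite -up_lubell0; apply: up_lubell_le => // A.
rewrite inE => /andP[Ar AF].
(* Since [A] is not a root, the bound holds even for all of [F] above [A]. *)
apply: le_trans (up_lubell_sub _ _ (subsetDl _ _)) _.
have [Z [AZ ZM noZ]] : exists Z : {set {set 'I_n}}, [/\ A \notin Z, (#|Z| <= M)%N &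
    ~ exists g : P -> {set 'I_n}, [/\ injective g, forall x, g x \in F :\: Z,
        {homo g : x y / (x <= y)%O >-> x \subset y} & g a = A]].
  apply: contrapT => noZ; move: Ar; rewrite inE AF /= => /negP; apply; apply/asboolP.
  by move=> Z AZ ZM; apply: contrapT => h; apply: noZ; exists Z.
have An : (#|A| <= n)%N by rewrite -[X in (_ <= X)%N]card_ord max_card.
have mE : (n - #|A|)%:R = n%:R - #|A|%:R :> R by rewrite natrB.
have mlarge : N0%:R + M%:R / (eps / 2) < (n - #|A|)%:R.
  by rewrite mE; have := Fsize A AF; lra.
have m0 : (0 : R) < (n - #|A|)%:R.
  by apply: le_lt_trans mlarge; rewrite addr_ge0.
have part1 : up_lubell R A (F :\: Z) <= (e_of P)%:R + eps / 2.
  apply: (up_lubell_free (ltW b1) hN0).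
  - by rewrite -(ler_nat R) ltW // (le_lt_trans _ mlarge) // lerDl.
  (* Lowering the bottom of a copy [h] to [A] keeps it a copy, contradicting the choice of [Z]. *)
  - move=> [h [hinj hF hmono]]; apply: noZ.
    have hA x : A \subset h x by have := hF x; rewrite inE => /andP[].
    have hneq x : x != a -> h x != A.
      move=> xa; apply: contraNneq xa => hxA; apply/eqP/hinj/eqP.
      by rewrite eqEsubset (hmono _ _ (amin x)) hxA hA.
    exists (fun x => if x == a then A else h x); split=> [x y|x|x y xy|].
    + case: eqP => [->|/eqP xa]; case: eqP => [->|/eqP ya] //.
      * by move=> e; move: (hneq y ya); rewrite -e eqxx.
      * by move=> e; move: (hneq x xa); rewrite e eqxx.
      * exact: hinj.
    + case: eqP => _; first by rewrite inE AZ AF.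
      by have := hF x; rewrite inE => /andP[].
    + case: eqP => [_|/eqP xa]; first by case: eqP => _; [exact: subxx|exact: hA].
      case: eqP => [ya|_]; last exact: hmono.
      by case/eqP: xa; apply: le_anti; rewrite amin -ya xy.
    + by rewrite eqxx.
  - by move=> B /setDP[/Fsize].
(* [Z] misses [A] and [F] misses the full set, so each of the at most [M] terms is at most
   [1 / (n - #|A|)]. *)
have part2 : \sum_(B in F | (A \subset B) && (B \in Z))
    ('C(n - #|A|, #|B| - #|A|)%:R)^-1 <= eps / 2 :> R.
  apply: (@le_trans _ _ (\sum_(B in Z) (n - #|A|)%:R^-1)); last first.
    rewrite sumr_const -[X in X <= _]mulr_natl ler_pdivrMr // mulrC -ler_pdivrMr //.
    apply: le_trans (ltW mlarge); rewrite ler_wpDl // ler_pM2r ?invr_gt0 //.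
    by rewrite ler_nat.
  rewrite [X in X <= _]big_mkcond [X in _ <= X]big_mkcond; apply: ler_sum => B _.
  case: ifP => [/and3P[BF AB BZ]|_]; last by case: ifP; rewrite // invr_ge0 ltW.
  rewrite BZ lef_pV2 ?posrE //; last first.
    rewrite ltr0n bin_gt0 leq_sub2r //.
    by rewrite -[X in (_ <= X)%N]card_ord max_card.
  have ltAB : (#|A| < #|B|)%N.
    apply: proper_card; rewrite properEneq AB andbT.
    by apply: contraNneq AZ => ->.
  have ltBn : (#|B| < n)%N.
    rewrite -(ltr_nat R); apply: lt_le_trans (Fsize B BF) _.
    by rewrite ler_piMl // ltW.
  rewrite ler_nat; apply: leq_bin_id.
  by rewrite subn_gt0 ltAB ltn_sub2r // (ltn_trans ltAB).
have -> : up_lubell R A F = up_lubell R A (F :\: Z) + \sum_(B in F | (A \subset B) && (B \in Z))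
    ('C(n - #|A|, #|B| - #|A|)%:R)^-1.
  rewrite /up_lubell (bigID (mem Z)) /= addrC; congr (_ + _); apply: eq_bigl => B.
    by rewrite inE andbC andbA.
  by rewrite andbA.
by lra.
Qed.

(** * Stacking the copies along the peeled families *)

Section Embedding.
Variables (d : Order.disp_t) (k : nat) (P : 'I_k -> finPOrderType d).
Variables (a b : forall i, P i) (n : nat) (F : {set {set 'I_n}}).

Notation S := {i : 'I_k & P i}.

(** The last index of [s] is peeled first. The budget [#|{: S}|] covers all sets that a partial
    stacking can have used. *)
Definition peel (s : seq 'I_k) : {set {set 'I_n}} :=
  foldr (fun i G => roots (a i) #|{: S}| G) F s.

Lemma peel_sub s : peel s \subset F.
Proof.
elim: s => [|i s IH] /=; first exact: subxx.
exact: subset_trans (roots_sub _ _ _) IH.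
Qed.

Lemma peel_drop (i : 'I_k) :
  peel (drop i (enum 'I_k)) = roots (a i) #|{: S}| (peel (drop i.+1 (enum 'I_k))).
Proof. by rewrite (drop_nth i) ?size_enum_ord // nth_ord_enum. Qed.

(* [P 0], [P 1], ... are embedded one after the other, the bottom of [P j]
   being sent to the image of the glueing point of [P (j - 1)] and the rest of
   [P j] avoiding everything used before. *)
Lemma peel_stage (A0 : {set 'I_n}) j : A0 \in peel (enum 'I_k) -> (j <= k)%N ->
  exists (h : forall i, P i -> {set 'I_n}) (A : {set 'I_n}),
  [/\ forall (i : 'I_k) x, (i < j)%N -> h i x \in F,
      forall i : 'I_k, (i < j)%N -> {homo h i : x y / (x <= y)%O >-> x \subset y},
      forall i i' : 'I_k, i' = i.+1 :> nat -> (i' < j)%N -> h i (b i) = h i' (a i'),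
      forall (i i' : 'I_k) x y, (i < j)%N -> (i' < j)%N -> h i x = h i' y ->
        glue_equiv a b (Tagged P x) (Tagged P y) &
      A \in peel (drop j (enum 'I_k)) /\
      forall i : 'I_k, i.+1 = j -> h i (b i) = A].
Proof.
move=> hA0; elim: j => [|j IH] jk.
  by exists (fun _ _ => set0), A0; split=> //; rewrite drop0.
have [h [A [hF hmono hglue hinj [Apeel hA]]]] := IH (ltnW jk).
pose o := Ordinal jk.
(* [A] is kept available, being the bottom of the next copy. *)
pose Z := [set h (tag u) (tagged u) | u in [set u : S | (tag u < j)%N]] :\ A.
have AZ : A \notin Z by rewrite !inE eqxx.
have ZM : (#|Z| <= #|{: S}|)%N.
  apply: leq_trans (subset_leq_card (subsetDl _ _)) _.
  exact: leq_trans (leq_imset_card _ _) (max_card _).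
have Anew : A \in roots (a o) #|{: S}| (peel (drop j.+1 (enum 'I_k))).
  by rewrite -(peel_drop o).
move: Anew; rewrite inE => /andP[_ /asboolP /(_ Z AZ ZM)[g [ginj gF gmono ga]]].
pose h' := dfwith h g; have h'o : h' o = g by exact: dfwith_in.
have h'lt (i : 'I_k) : (i < j)%N -> h' i = h i.
  move=> ij; apply: dfwith_out; apply: contraTneq ij => <-.
  by rewrite ltnn.
have lt_o (i : 'I_k) : (i < j.+1)%N -> (i < j)%N \/ i = o.
  by rewrite ltnS leq_eqVlt => /orP[/eqP ij|]; [right; apply: val_inj|left].
(* An old and a new image can only meet at [A], hence at [a o] and at points glued to [b i0], where
   [i0] precedes [o]. *)
have gnew (i : 'I_k) x y : (i < j)%N -> h i x = g y ->
    glue_equiv a b (Tagged P x) (Tagged P y).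
  move=> ij hg; have : g y \in Z -> False.
    by have := gF y; rewrite inE => /andP[/negP].
  rewrite !inE -hg; case: eqP => [hxA _|_ []] /=; last first.
    by apply/imsetP; exists (Tagged P x); rewrite ?inE.
  have -> : y = a o by apply: ginj; rewrite -hg ga.
  have jk' : (j.-1 < k)%N by lia.
  pose i0 := Ordinal jk'; have i0j : i0.+1 = j by rewrite /=; lia.
  apply: (@glue_equiv_trans _ _ _ _ _ (Tagged P (b i0))).
    by apply: hinj => //; [rewrite /=; lia|rewrite hA].
  by apply: glue_equiv_step; rewrite i0j.
exists h', (g (b o)); split.
- move=> i x /lt_o[ij|io]; first by rewrite h'lt //; apply: hF.
  by subst i; rewrite h'o; have := gF x; rewrite inE => /andP[_]; apply: (subsetP (peel_sub _)).
- by move=> i /lt_o[ij|io]; [rewrite h'lt //; apply: hmono|subst i; rewrite h'o].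
- move=> i i' ii' /lt_o[ij|io].
    by rewrite !h'lt //; [apply: hglue|lia].
  subst i'; rewrite h'o ga h'lt; first by apply: hA.
  by move: ii' => /= ->.
- move=> i i' x y /lt_o[ij|io] /lt_o[ij'|io'].
  + by rewrite !h'lt //; apply: hinj.
  + by subst i'; rewrite h'o h'lt //; apply: gnew.
  + subst i; rewrite h'o h'lt // => e; rewrite glue_equiv_sym.
    by apply: gnew => //; rewrite e.
  + by subst i i'; rewrite h'o => /ginj ->; apply: glue_equiv_refl.
- split; first by have := gF (b o); rewrite inE => /andP[].
  move=> i [ij]; have io : i = o by apply: val_inj.
  by subst i; rewrite h'o.
Qed.

Lemma peel_glued (A0 : {set 'I_n}) :
  A0 \in peel (enum 'I_k) -> subposet_of (glued a b) F.
Proof.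
move=> /peel_stage /(_ (leqnn k))[h [A [hF hmono hglue hinj _]]].
apply: (@glued_subposet _ _ _ _ _ _ _ h) => //.
- by move=> i x; apply: hF.
- by move=> i; apply: hmono.
- by move=> i i' ii'; apply: hglue.
- by move=> i i' x y; apply: hinj.
Qed.

End Embedding.

Theorem theorem7p1 (R : realType) (d : Order.disp_t) (k : nat) (hk : (0 < k)%N)
    (P : 'I_k -> finPOrderType d) (a b : forall i : 'I_k, P i)
    (hP : forall i : 'I_k, lower_L_bounded R (P i))
    (h0 : forall i : 'I_k, has_hat0 (P i))
    (hI : forall i : 'I_k, large_interval (a i) (b i)) :
  lower_L_bounded R (glued a b).
Proof.
move=> beta eps hbeta eps0.
have amin i x : (a i <= x)%O by apply: large_interval_hat0 (h0 i) (hI i) x.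
(* An equal share of [eps] for each of the [k] peelings. *)
have epsk : 0 < eps / k%:R by rewrite divr_gt0 // ltr0n.
pose M := #|{: {i : 'I_k & P i}}|.
have [N hN] := fin_all_exists (fun i =>
  lubell_setD_roots M (amin i) (hP i) hbeta epsk).
exists (\max_i N i) => n hn F Ffree Fsize.
(* Each peeling discards a layer of Lubell value at most [e_of (P i) + eps / k]. *)
have step s : lubell R F <=
    \sum_(i <- s) ((e_of (P i))%:R + eps / k%:R) + lubell R (peel a F s).
  elim: s => [|i s IH]; first by rewrite big_nil add0r.
  have split_i : lubell R (peel a F s) =
      lubell R (peel a F (i :: s)) + lubell R (peel a F s :\: peel a F (i :: s)).
    rewrite !lubellE (big_setID (peel a F (i :: s))) /=.
    by rewrite (setIidPr (roots_sub _ _ _)).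
  have : lubell R (peel a F s :\: peel a F (i :: s)) <= (e_of (P i))%:R + eps / k%:R.
    apply: hN; first exact: leq_trans (leq_bigmax i) hn.
    by move=> A /(subsetP (peel_sub _ _ _)) /Fsize.
  by rewrite big_cons; lra.
have peel0 : peel a F (enum 'I_k) = set0.
  by apply/setP=> A; rewrite inE; apply/negP => /(peel_glued b) /Ffree.
apply: le_trans (step (enum 'I_k)) _.
rewrite peel0 lubellE big_set0 addr0 big_enum /= big_split /= sumr_const card_ord.
rewrite -[_ / _ *+ _]mulr_natr divfK ?pnatr_eq0 -?lt0n // lerD2r -natr_sum ler_nat.
by apply: e_of_glued => // i; have [] := hI i.
Qed.
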